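(* Let $(\mathsf{G}\text{-}\mathsf{HSfT},\preceq_{\rm hyp})$ be the category of nd-semiring systems of hyper-type $(\mathcal A,\mathcal T,(-),\preceq)$ with $\mathcal T=\mathcal A^\times$, with $\preceq$-morphisms, and let $\mathsf{FR}$ be the category of coherent fuzzy rings with fuzzy morphisms. There is a functor from $(\mathsf{G}\text{-}\mathsf{HSfT},\preceq_{\rm hyp})$ to $\mathsf{FR}$, sending an nd-semiring system of hyper-type $(\mathcal A,\mathcal T,(-),\preceq)$ to the fuzzy ring $\mathcal A$ with the distinguished element $\varepsilon=(-)1$ and the proper ideal $\mathcal I=\mathcal A_{\rm Null}$.
   Context: **Systems.** Let $(\mathcal A,+,0)$ be a commutative additive monoid with a subset $\mathcal T\subset\mathcal A$, $0\notin\mathcal T$, $\mathcal T_0=\mathcal T\cup\{0\}$. $\mathcal A$ is a $\mathcal T$-gen bimodule if $\mathcal T_0$ is a multiplicative monoid with unit $1\in\mathcal T$, additively generates $\mathcal A$, and acts on $\mathcal A$ on the left with $(a_1a_2)b=a_1(a_2b)$, $0b=0$, $1b=b$, $a1=a$, $a0=0$, $a\sum b_i=\sum ab_i$ ($a,a_i\in\mathcal T_0$, $b,b_i\in\mathcal A$), and likewise on the right. It is a $\mathcal T$-gen nd-semiring if moreover $(\mathcal A,\cdot,1)$ is a multiplicative monoid with $0$ absorbing whose multiplication restricts to the $\mathcal T_0$-actions (full distributivity is not required). A negation map is an additive isomorphism $(-):\mathcal A\to\mathcal A$ of order $\le2$ with $(-)1\in\mathcal T$ and $((-)a)b=(-)(ab)=a((-)b)$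 for $a\in\mathcal T,b\in\mathcal A$ (similarly on the right). Write $b(-)c=b+((-)c)$, $b^\circ=b(-)b$, $\mathcal A^\circ=\{b^\circ\}$. A triple is a $\mathcal T$-gen bimodule with a negation map such that $\mathcal A^\circ\cap\mathcal T=\emptyset$. A surpassing relation $\preceq$ is a reflexive transitive relation with: $b\preceq0\Rightarrow b=0$; $0\preceq b^\circ$; $b_i\preceq b_i'$ ($i=1,2$) implies $a_1b_1+a_2b_2\preceq a_1b_1'+a_2b_2'$ and $b_1a_1+b_2a_2\preceq b_1'a_1+b_2'a_2$ for $a_i\in\mathcal T$, and (for nd-semirings) $b_1b_2\preceq b_1'b_2'$; $a\preceq a'$ with $a,a'\in\mathcal T_0$ implies $a=a'$. Put $\mathcal A_{\rm Null}=\{b:0\preceq b\}$. A system is a triple with a surpassing relation such that $a,a'\in\mathcal T$ and $a(-)a'\in\mathcal A_{\rm Null}$ imply $a=a'$; an nd-semiring system is one where $\mathcal A$ is a $\mathcal T$-gen nd-semiring. It is of hyper-type if whenever $b_i,b_i'\in\mathcal A$ and $\sum_ib_ib_i'\in\mathcal A_{\rm Null}$ there are $a_i,a_i'\in\mathcal T_0$ with $a_i\preceq b_i$, $a_i'\preceq b_i'$ and $\sum_ia_ia_i'\in\mathcal A_{\rm Null}$. $\mathcal A^\times$ is the set of multiplicatively invertible elements. A $\preceq$-morphism is a map $f:\mathcal A\to\mathcal A'$ restricting to a monoid homomorphism $\mathcal T\to\mathcal T'$ with $f(0)=0'$, $f(ab)=f(a)f(b)$, $f(ba)=f(b)f(a)$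 ($a\in\mathcal T,b\in\mathcal A$), $b_1\preceq b_2\Rightarrow f(b_1)\preceq'f(b_2)$ and $f(b_1+b_2)\preceq'f(b_1)+f(b_2)$. **Fuzzy rings.** $(\mathcal A,+,\cdot,0,1)$ is a fuzzy ring if it is an $\mathcal A^\times$-gen bimodule (where $(\mathcal A,\cdot,1)$ is a multiplicative monoid with $0$ absorbing whose multiplication restricts to the left and right actions of $\mathcal A^\times\cup\{0\}$ on $\mathcal A$, full distributivity not being required) and has a distinguished element $\varepsilon$ and a proper ideal $\mathcal I$ such that, for $b_i\in\mathcal A$: (1) $\varepsilon^2=1$; (2) $a=\varepsilon$ iff $a\in\mathcal A^\times$ and $1+a\in\mathcal I$; (3) if $b_1+b_2,\ b_3+b_4\in\mathcal I$ then $b_1b_3+\varepsilon b_2b_4\in\mathcal I$; (4) if $b_1+b_2(b_3+b_4)\in\mathcal I$ then $b_1+b_2b_3+b_2b_4\in\mathcal I$. It is coherent if $\mathcal A^\times$ spans $(\mathcal A,+)$. A fuzzy morphism $(\mathcal A,\mathcal I)\to(\mathcal A',\mathcal I')$ is a map $f:\mathcal A\to\mathcal A'$ with $f(\mathcal A^\times\cup\{0\})\subseteq\mathcal A'^\times\cup\{0'\}$, $f(0)=0'$, $f(1)=1'$, $f(ab)=f(a)f(b)$, $f(ba)=f(b)f(a)$ for $a\in\mathcal A^\times,b\in\mathcal A$, such that $\sum b_ic_i\in\mathcal I$ implies $\sum f(b_i)f(c_i)\in\mathcal I'$ for all $b_i,c_i\in\mathcal A$. *)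

(* Defs.v *)
From mathcomp Require Import all_boot ssralg.
From mathcomp Require Import boolp classical_sets.

Set Implicit Arguments.
Unset Strict Implicit.
Unset Printing Implicit Defensive.

Import GRing.Theory.
Local Open Scope classical_set_scope.
Local Open Scope ring_scope.

Record category := Category {
  obj :> Type;
  hom : obj -> obj -> Type;
  idm : forall X, hom X X;
  comp : forall X Y Z, hom Y Z -> hom X Y -> hom X Z;
  comp_idl : forall X Y (f : hom X Y), comp (idm Y) f = f;
  comp_idr : forall X Y (f : hom X Y), comp f (idm X) = f;
  compA : forall X Y Z W (h : hom Z W) (g : hom Y Z) (f : hom X Y),
    comp h (comp g f) = comp (comp h g) f }.

Arguments hom {c}.
Arguments idm {c}.
Arguments comp {c X Y Z}.

(* The object map is a parameter, so that it can be prescribed in a statement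
   and the morphism map compared with given maps without transports. *)
Record functor_on (C D : category) (Fobj : C -> D) := FunctorOn {
  fmap : forall X Y, hom X Y -> hom (Fobj X) (Fobj Y);
  fmap_id : forall X, fmap (idm X) = idm (Fobj X);
  fmap_comp : forall X Y Z (g : hom Y Z) (f : hom X Y),
    fmap (comp g f) = comp (fmap g) (fmap f) }.

Arguments functor_on : clear implicits.
Arguments fmap {C D Fobj} _ {X Y}.

Section Systems.
Context {A : nmodType}.
Implicit Types (T I : set A) (a b c one : A) (neg : A -> A).
Implicit Types (mul tmul lact ract : A -> A -> A) (le : A -> A -> Prop).

Definition adjoin0 T : set A := T `|` [set 0].

Definition additively_generates T : Prop :=
  forall b, exists2 s : seq A, {in s, forall a, T a} & b = \sum_(a <- s) a.

(* The operations [tmul], [lact] and [ract] are total functions on [A]: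
   [tmul] (the product of T_0) is only constrained on T_0 x T_0, and [lact a b]
   (= ab), [ract b a] (= ba) are only constrained for [a] in T_0. *)
Record left_action T one tmul lact : Prop := {
  act_mul : forall a a' b, adjoin0 T a -> adjoin0 T a' ->
    lact (tmul a a') b = lact a (lact a' b);
  act_0l : forall b, lact 0 b = 0;
  act_1l : forall b, lact one b = b;
  act_1r : forall a, adjoin0 T a -> lact a one = a;
  act_0r : forall a, adjoin0 T a -> lact a 0 = 0;
  act_sum : forall a n (b : 'I_n -> A), adjoin0 T a ->
    lact a (\sum_i b i) = \sum_i lact a (b i) }.

Record gen_bimodule T one tmul lact ract : Prop := {
  gen_notin0 : ~ T 0;
  gen_one : T one;
  gen_mul : forall a a', adjoin0 T a -> adjoin0 T a' ->
    adjoin0 T (tmul a a');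
  gen_mulA : forall a a' a'', adjoin0 T a -> adjoin0 T a' -> adjoin0 T a'' ->
    tmul a (tmul a' a'') = tmul (tmul a a') a'';
  gen_mul1l : forall a, adjoin0 T a -> tmul one a = a;
  gen_mul1r : forall a, adjoin0 T a -> tmul a one = a;
  gen_span : additively_generates (adjoin0 T);
  gen_left : left_action T one tmul lact;
  gen_right : left_action T one (fun a a' => tmul a' a) (fun a b => ract b a) }.

Record negation_map T one lact ract neg : Prop := {
  neg_0 : neg 0 = 0;
  neg_add : {morph neg : b c / b + c};
  neg_invol : involutive neg;
  neg_one : T (neg one);
  neg_left : forall a b, T a ->
    lact (neg a) b = neg (lact a b) /\ neg (lact a b) = lact a (neg b);
  neg_right : forall a b, T a ->
    ract b (neg a) = neg (ract b a) /\ neg (ract b a) = ract (neg b) a }.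

Definition quasizero neg b : A := b + neg b.

Record triple T one tmul lact ract neg : Prop := {
  triple_gen : gen_bimodule T one tmul lact ract;
  triple_neg : negation_map T one lact ract neg;
  triple_disj : range (quasizero neg) `&` T = set0 }.

Record surpassing T lact ract neg le : Prop := {
  sur_refl : forall b, le b b;
  sur_trans : forall b c d, le b c -> le c d -> le b d;
  sur_0 : forall b, le b 0 -> b = 0;
  sur_quasizero : forall b, le 0 (quasizero neg b);
  sur_left : forall a1 a2 b1 b1' b2 b2', T a1 -> T a2 ->
    le b1 b1' -> le b2 b2' ->
    le (lact a1 b1 + lact a2 b2) (lact a1 b1' + lact a2 b2');
  sur_right : forall a1 a2 b1 b1' b2 b2', T a1 -> T a2 ->
    le b1 b1' -> le b2 b2' ->
    le (ract b1 a1 + ract b2 a2) (ract b1' a1 + ract b2' a2);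
  sur_eq : forall a a', adjoin0 T a -> adjoin0 T a' -> le a a' -> a = a' }.

Definition null le : set A := [set b | le 0 b].

Record system T one tmul lact ract neg le : Prop := {
  sys_triple : triple T one tmul lact ract neg;
  sys_sur : surpassing T lact ract neg le;
  sys_uniq : forall a a', T a -> T a' -> null le (a + neg a') -> a = a' }.

(* The multiplication restricts to the product of T_0 and to both actions, so
   it takes the place of all three in [gen_bimodule]. *)
Record nd_semiring T one mul : Prop := {
  nd_mulA : associative mul;
  nd_mul1l : left_id one mul;
  nd_mul1r : right_id one mul;
  nd_mul0l : left_zero 0 mul;
  nd_mul0r : right_zero 0 mul;
  nd_gen : gen_bimodule T one mul mul mul }.

Record nd_semiring_system T one mul neg le : Prop := {
  nds_nd : nd_semiring T one mul;
  nds_sys : system T one mul mul mul neg le;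
  nds_mul : forall b1 b1' b2 b2',
    le b1 b1' -> le b2 b2' -> le (mul b1 b2) (mul b1' b2') }.

Definition hyper_type T mul le : Prop :=
  forall n (b b' : 'I_n -> A), null le (\sum_i mul (b i) (b' i)) ->
  exists a a' : 'I_n -> A,
    [/\ forall i, adjoin0 T (a i) /\ adjoin0 T (a' i),
        forall i, le (a i) (b i) /\ le (a' i) (b' i) &
        null le (\sum_i mul (a i) (a' i))].

Definition units one mul : set A :=
  [set a | exists b, mul a b = one /\ mul b a = one].

Record ideal mul I : Prop := {
  ideal_0 : I 0;
  ideal_add : forall b c, I b -> I c -> I (b + c);
  ideal_mull : forall b c, I c -> I (mul b c);
  ideal_mulr : forall b c, I b -> I (mul b c) }.

Record fuzzy_ring one mul (eps : A) I : Prop := {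
  fuzzy_nd : nd_semiring (units one mul) one mul;
  fuzzy_ideal : ideal mul I;
  fuzzy_proper : I <> setT;
  fuzzy_eps2 : mul eps eps = one;
  fuzzy_epsP : forall a, a = eps <-> units one mul a /\ I (one + a);
  fuzzy_mul : forall b1 b2 b3 b4, I (b1 + b2) -> I (b3 + b4) ->
    I (mul b1 b3 + mul (mul eps b2) b4);
  fuzzy_distr : forall b1 b2 b3 b4, I (b1 + mul b2 (b3 + b4)) ->
    I (b1 + mul b2 b3 + mul b2 b4) }.

Record coherent_fuzzy_ring one mul (eps : A) I : Prop := {
  coh_fuzzy : fuzzy_ring one mul eps I;
  coh_span : additively_generates (units one mul) }.

End Systems.

Record ndSystem := NdSystem {
  nds_car :> nmodType;
  nds_T : set nds_car;
  nds_1 : nds_car;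
  nds_op : nds_car -> nds_car -> nds_car;
  nds_neg : nds_car -> nds_car;
  nds_le : nds_car -> nds_car -> Prop;
  nds_ax : nd_semiring_system nds_T nds_1 nds_op nds_neg nds_le }.

Arguments nds_T : clear implicits.
Arguments nds_op : clear implicits.
Arguments nds_neg : clear implicits.
Arguments nds_le : clear implicits.

Record hsft := Hsft {
  hsft_sys :> ndSystem;
  hsft_hyper : hyper_type (nds_T hsft_sys) (nds_op hsft_sys) (nds_le hsft_sys);
  hsft_units : nds_T hsft_sys = units (nds_1 hsft_sys) (nds_op hsft_sys) }.

Record le_morphism (S S' : ndSystem) (f : S -> S') : Prop := {
  lem_T : forall a, nds_T S a -> nds_T S' (f a);
  lem_1 : f (nds_1 S) = nds_1 S';
  lem_0 : f 0 = 0;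
  lem_mull : forall a b, nds_T S a -> f (nds_op S a b) = nds_op S' (f a) (f b);
  lem_mulr : forall a b, nds_T S a -> f (nds_op S b a) = nds_op S' (f b) (f a);
  lem_le : forall b1 b2, nds_le S b1 b2 -> nds_le S' (f b1) (f b2);
  lem_add : forall b1 b2, nds_le S' (f (b1 + b2)) (f b1 + f b2) }.

Record leHom (S S' : ndSystem) := LeHom {
  leHom_fun :> S -> S';
  leHomP : le_morphism leHom_fun }.

Lemma leHom_eq (S S' : ndSystem) (f g : leHom S S') :
  leHom_fun f = leHom_fun g -> f = g.
Proof.
by case: f g => f Pf [g Pg] /= e; subst g; rewrite (Prop_irrelevance Pf Pg).
Qed.

Lemma le_morphism_id (S : ndSystem) : le_morphism (@id S).
Proof.
have [_ [_ [r _ _ _ _ _ _] _] _] := nds_ax S.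
by split=> // b1 b2; apply: r.
Qed.

Lemma le_morphism_comp (S S' S'' : ndSystem) (g : S' -> S'') (f : S -> S') :
  le_morphism g -> le_morphism f -> le_morphism (g \o f).
Proof.
move=> [gT g1 g0 gl gr gle gD] [fT f1 f0 fl fr fle fD].
have [_ [_ [_ t _ _ _ _ _] _] _] := nds_ax S''.
split=> /= [a /fT/gT //|||a b Ta|a b Ta|b c /fle/gle //|b c].
- by rewrite f1.
- by rewrite f0.
- by rewrite fl // gl //; apply: fT.
- by rewrite fr // gr //; apply: fT.
- exact: t (gle _ _ (fD b c)) (gD _ _).
Qed.

Definition HSfT : category.
Proof.
refine (@Category hsft (fun S S' => leHom S S')
  (fun S => LeHom (le_morphism_id S))
  (fun S S' S'' g f => LeHom (le_morphism_comp (leHomP g) (leHomP f))) _ _ _);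
  by intros; apply: leHom_eq.
Defined.

Record fuzzyRing := FuzzyRing {
  fr_car :> nmodType;
  fr_1 : fr_car;
  fr_op : fr_car -> fr_car -> fr_car;
  fr_eps : fr_car;
  fr_I : set fr_car;
  fr_ax : coherent_fuzzy_ring fr_1 fr_op fr_eps fr_I }.

Arguments fr_op : clear implicits.
Arguments fr_I : clear implicits.

Definition fr_units (K : fuzzyRing) : set K := units (fr_1 K) (fr_op K).

Arguments fr_units : clear implicits.

Record fuzzy_morphism (K K' : fuzzyRing) (f : K -> K') : Prop := {
  fm_units : forall a, adjoin0 (fr_units K) a -> adjoin0 (fr_units K') (f a);
  fm_0 : f 0 = 0;
  fm_1 : f (fr_1 K) = fr_1 K';
  fm_mull : forall a b, fr_units K a -> f (fr_op K a b) = fr_op K' (f a) (f b);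
  fm_mulr : forall a b, fr_units K a -> f (fr_op K b a) = fr_op K' (f b) (f a);
  fm_null : forall n (b c : 'I_n -> K),
    fr_I K (\sum_i fr_op K (b i) (c i)) ->
    fr_I K' (\sum_i fr_op K' (f (b i)) (f (c i))) }.

Record fuzzyHom (K K' : fuzzyRing) := FuzzyHom {
  fuzzyHom_fun :> K -> K';
  fuzzyHomP : fuzzy_morphism fuzzyHom_fun }.

Lemma fuzzyHom_eq (K K' : fuzzyRing) (f g : fuzzyHom K K') :
  fuzzyHom_fun f = fuzzyHom_fun g -> f = g.
Proof.
by case: f g => f Pf [g Pg] /= e; subst g; rewrite (Prop_irrelevance Pf Pg).
Qed.

Lemma fuzzy_morphism_id (K : fuzzyRing) : fuzzy_morphism (@id K).
Proof. by split. Qed.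

Lemma fuzzy_morphism_comp (K K' K'' : fuzzyRing) (g : K' -> K'') (f : K -> K') :
  fuzzy_morphism g -> fuzzy_morphism f -> fuzzy_morphism (g \o f).
Proof.
move=> [gU g0 g1 gl gr gI] [fU f0 f1 fl fr fI].
have [[[_ _ _ z' z'' _] _ _ _ _ _ _] _] := fr_ax K'.
have [[[_ _ _ w' w'' _] _ _ _ _ _ _] _] := fr_ax K''.
split=> /= [a /fU/gU //|||a b Ua|a b Ua|n b c /fI/gI //].
- by rewrite f0.
- by rewrite f1.
- rewrite fl //; have [/gl -> //|->] := fU a (or_introl Ua).
  by rewrite z' g0 w'.
- rewrite fr //; have [/gr -> //|->] := fU a (or_introl Ua).
  by rewrite z'' g0 w''.
Qed.

Definition FR : category.
Proof.
refine (@Category fuzzyRing fuzzyHom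
  (fun K => FuzzyHom (fuzzy_morphism_id K))
  (fun K K' K'' g f =>
     FuzzyHom (fuzzy_morphism_comp (fuzzyHomP g) (fuzzyHomP f))) _ _ _);
  by intros; apply: fuzzyHom_eq.
Defined.

(* Main.v *)
Require Import Defs.
From mathcomp Require Import all_boot ssralg.
From mathcomp Require Import boolp classical_sets.

(** The point of hyper-type is that membership in [null le] of a sum of products
    [\sum_i b i * b' i] is always inherited from a null sum of products of
    elements of [T_0] lying below the [b i], [b' i] ([hyper_type]), while
    conversely [null le] is closed upwards.  So each axiom of a fuzzy ring that
    is an implication between null sums can be checked after replacing
    arbitrary elements by elements of [T_0], where two things are available
    that fail in general.

    - Negatives are unique: if [a + a'] is null with [a, a'] in [T_0], then
      [a = (-)a'] ([null_addT0]).  Hence two null sums [a1 + a2], [a3 + a4]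
      multiply to [a1 a3 + (-)(a2 a4) = (a2 a4) (-) (a2 a4)], a quasizero, which
      is the multiplicative axiom ([null_mul_eps]).

    - Multiplication by [a] in [T_0] distributes over sums, so that a null
      [a1 + a2 a'] with [a'] below [b3 + b4] lies below [b1 + b2 b3 + b2 b4],
      which is the distributivity axiom ([null_distr]).

    A [le]-morphism [f] is multiplicative on [T_0] and subadditive up to [le],
    so it sends a null [\sum_i a i * a' i] with entries in [T_0] below
    [\sum_i f (a i) * f (a' i)]; monotonicity then gives the condition on
    null sums required of a fuzzy morphism ([le_morphism_fuzzy]). The functor
    leaves underlying maps untouched, whence its functoriality. *)

Set Implicit Arguments.
Unset Strict Implicit.
Unset Printing Implicit Defensive.

Import GRing.Theory.
Local Open Scope classical_set_scope.
Local Open Scope ring_scope.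

(** * The null ideal of an nd-semiring system *)

Section NdSemiringSystem.
Context {A : nmodType} {T : set A} {one : A} {mul : A -> A -> A}.
Context {neg : A -> A} {le : A -> A -> Prop}.
Hypothesis S : nd_semiring_system T one mul neg le.

Let nd := nds_nd S.
Let gen := nd_gen nd.
Let ngm := triple_neg (sys_triple (nds_sys S)).
Let sur := sys_sur (nds_sys S).

Lemma le_refl b : le b b.
Proof. exact: sur_refl sur b. Qed.

Lemma le_trans c b d : le b c -> le c d -> le b d.
Proof. exact: sur_trans sur b c d. Qed.

Lemma le_add b1 b1' b2 b2' :
  le b1 b1' -> le b2 b2' -> le (b1 + b2) (b1' + b2').
Proof.
move=> h1 h2; have T1 := gen_one gen.
by have := sur_left sur T1 T1 h1 h2; rewrite !(nd_mul1l nd).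
Qed.

Lemma le_sum (I : finType) (b b' : I -> A) :
  (forall i, le (b i) (b' i)) -> le (\sum_i b i) (\sum_i b' i).
Proof.
move=> h; apply: (big_ind2 le) => // [|*]; [exact: le_refl|exact: le_add].
Qed.

Lemma T0_one : adjoin0 T one.
Proof. by left; apply: gen_one gen. Qed.

Lemma neg1_mul b : mul (neg one) b = neg b.
Proof. by have [-> _] := neg_left ngm b (gen_one gen); rewrite (nd_mul1l nd). Qed.

Lemma neg_T a : T a -> T (neg a).
Proof.
move=> Ta; rewrite -neg1_mul.
have [//|] := gen_mul gen (or_introl (neg_one ngm)) (or_introl Ta).
rewrite neg1_mul /= => /(congr1 neg); rewrite (neg_invol ngm) (neg_0 ngm) => a0.
by case: (gen_notin0 gen); rewrite -a0.
Qed.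

Lemma neg1_mul_neg1 : mul (neg one) (neg one) = one.
Proof. by rewrite neg1_mul (neg_invol ngm). Qed.

Lemma mul_negT0 a b : adjoin0 T a -> adjoin0 T b ->
  mul (neg a) (neg b) = mul a b.
Proof.
case=> [Ta|->] [Tb|->]; rewrite ?(neg_0 ngm) ?(nd_mul0l nd) ?(nd_mul0r nd) //.
have [-> ->] := neg_left ngm (neg b) Ta.
by rewrite (neg_invol ngm).
Qed.

Lemma mul_distrT0 a b c : adjoin0 T a -> mul a (b + c) = mul a b + mul a c.
Proof.
move=> Ta.
have := act_sum (gen_left gen) (fun i : 'I_2 => if i == ord0 then b else c) Ta.
by rewrite !big_ord_recl !big_ord0 !addr0.
Qed.

Lemma null_le b c : le b c -> null le b -> null le c.
Proof. by move=> bc b0; apply: le_trans bc. Qed.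

Lemma null_ideal : ideal mul (null le).
Proof.
split=> [|b c b0 c0|b c c0|b c b0]; rewrite /null /=.
- exact: le_refl.
- by rewrite -[0]addr0; apply: le_add.
- by rewrite -(nd_mul0r nd b); apply: (nds_mul S) => //; apply: le_refl.
- by rewrite -(nd_mul0l nd c); apply: (nds_mul S) => //; apply: le_refl.
Qed.

Lemma null_T0 a : adjoin0 T a -> null le a -> a = 0.
Proof. by move=> Ta a0; rewrite -(sur_eq sur _ Ta a0) //; right. Qed.

Lemma null_proper : null le <> setT.
Proof.
move=> nT; have /(null_T0 T0_one) e : null le one by rewrite nT.
by case: (gen_notin0 gen); rewrite -e; apply: gen_one gen.
Qed.

Lemma null_addT0 a a' : adjoin0 T a -> adjoin0 T a' ->
  null le (a + a') -> a = neg a'.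
Proof.
move=> [Ta|->] [Ta'|->] h.
- apply: (sys_uniq (nds_sys S)) => //; first exact: neg_T.
  by rewrite (neg_invol ngm).
- move: h; rewrite addr0 (neg_0 ngm); apply: null_T0; by left.
- move: h; rewrite add0r => /null_T0 ->; [by rewrite (neg_0 ngm)|by left].
- by rewrite (neg_0 ngm).
Qed.

Lemma eps_unique a : a = neg one <-> T a /\ null le (one + a).
Proof.
split=> [->|[Ta]]; first by split; [apply: neg_one ngm|apply: sur_quasizero sur _].
by move/(null_addT0 T0_one (or_introl Ta)) ->; rewrite (neg_invol ngm).
Qed.

Lemma additively_generates_T : additively_generates T.
Proof.
move=> b; have [s sT ->] := gen_span gen b.
exists [seq a <- s | a != 0]; last first.
  by rewrite big_filter [LHS](bigID (fun a => a != 0)) /= [X in _ + X]big1 ?addr0 //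
    => a; rewrite negbK => /eqP.
move=> a; rewrite mem_filter => /andP[a0 /sT[//|/= e]].
by rewrite e eqxx in a0.
Qed.

(** * Consequences of hyper-type *)

Section HyperType.
Hypothesis hyp : hyper_type T mul le.

(** Hyper-type only speaks of sums of products; summands [b] enter as
    [b * one], and [one] is the only element of [T_0] below [one]. *)
Lemma hyper_type_add_mul b1 b2 b3 : null le (b1 + mul b2 b3) ->
  exists a1 a2 a3,
    [/\ [/\ adjoin0 T a1, adjoin0 T a2 & adjoin0 T a3],
        [/\ le a1 b1, le a2 b2 & le a3 b3] & null le (a1 + mul a2 a3)].
Proof.
move=> h.
have [|a [a' [T0 lea]]] := hyp (n := 2) (b := fun i => if i == ord0 then b1 else b2)
  (b' := fun i => if i == ord0 then one else b3).
  by rewrite !big_ord_recl big_ord0 /= addr0 (nd_mul1r nd).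
rewrite !big_ord_recl big_ord0 addr0.
have [[Ta1 T1] [le1 /= leone]] := (T0 ord0, lea ord0).
rewrite (sur_eq sur T1 T0_one leone) (nd_mul1r nd) => n.
set i1 := lift _ _ in n; have [[Ta2 Ta3] [le2 le3]] := (T0 i1, lea i1).
by exists (a ord0), (a i1), (a' i1); split.
Qed.

Lemma hyper_type_add b1 b2 : null le (b1 + b2) ->
  exists a, [/\ adjoin0 T a, le (neg a) b1 & le a b2].
Proof.
rewrite -[b2 in _ + b2](nd_mul1r nd) => /hyper_type_add_mul.
move=> [a1 [a2 [a3 [[Ta1 Ta2 Ta3] [le1 le2 le3]]]]].
rewrite (sur_eq sur Ta3 T0_one le3) (nd_mul1r nd) => /null_addT0 e.
by exists a2; rewrite -e.
Qed.

(** Below the two null sums lie [(-)a + a] and [(-)a' + a'], and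
    [((-)a)((-)a') + (-)(a a')] is the quasizero of [a a']. *)
Lemma null_mul_eps b1 b2 b3 b4 : null le (b1 + b2) -> null le (b3 + b4) ->
  null le (mul b1 b3 + mul (mul (neg one) b2) b4).
Proof.
move=> /hyper_type_add[a [Ta le1 le2]] /hyper_type_add[a' [Ta' le3 le4]].
rewrite -(nd_mulA nd).
apply: (@null_le (mul (neg a) (neg a') + mul (neg one) (mul a a'))).
  by apply: le_add; do ![apply: (nds_mul S) => //]; apply: le_refl.
by rewrite mul_negT0 // neg1_mul; apply: sur_quasizero sur _.
Qed.

Lemma null_distr b1 b2 b3 b4 : null le (b1 + mul b2 (b3 + b4)) ->
  null le (b1 + mul b2 b3 + mul b2 b4).
Proof.
move=> /hyper_type_add_mul[a1 [a2 [a3 [[Ta1 Ta2 Ta3] [le1 le2 le3]]]]].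
apply: null_le; rewrite -addrA; apply: le_add => //.
apply: (@le_trans (mul a2 (b3 + b4))).
  by apply: (nds_mul S) => //; apply: le_refl.
rewrite mul_distrT0 //.
by apply: le_add; apply: (nds_mul S) => //; apply: le_refl.
Qed.

Lemma hyper_type_coherent_fuzzy_ring : T = units one mul ->
  coherent_fuzzy_ring one mul (neg one) (null le).
Proof.
move=> eT; split; last by rewrite -eT; apply: additively_generates_T.
split; rewrite -?eT.
- exact: nd.
- exact: null_ideal.
- exact: null_proper.
- exact: neg1_mul_neg1.
- exact: eps_unique.
- exact: null_mul_eps.
- exact: null_distr.
Qed.

End HyperType.
End NdSemiringSystem.

(** * Morphisms and the functor *)

Section LeMorphism.
Context {S S' : ndSystem} {f : S -> S'}.
Hypothesis Pf : le_morphism f.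

Lemma le_morphism_sum n (b : 'I_n -> S) :
  nds_le S' (f (\sum_i b i)) (\sum_i f (b i)).
Proof.
elim: n b => [|n IHn] b.
  by rewrite !big_ord0 (lem_0 Pf); apply: le_refl (nds_ax S') _.
rewrite !big_ord_recl; apply: (le_trans (nds_ax S') (lem_add Pf _ _)).
exact: (le_add (nds_ax S') (le_refl (nds_ax S') _) (IHn _)).
Qed.

Lemma le_morphism_mulT0 a b : adjoin0 (nds_T S) a ->
  f (nds_op S a b) = nds_op S' (f a) (f b).
Proof.
case=> [Ta|->]; first exact: (lem_mull Pf).
by rewrite (nd_mul0l (nds_nd (nds_ax S))) (lem_0 Pf)
  (nd_mul0l (nds_nd (nds_ax S'))).
Qed.

Lemma le_morphism_null n (b c : 'I_n -> S) :
  hyper_type (nds_T S) (nds_op S) (nds_le S) ->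
  null (nds_le S) (\sum_i nds_op S (b i) (c i)) ->
  null (nds_le S') (\sum_i nds_op S' (f (b i)) (f (c i))).
Proof.
move=> hyp /hyp[a [a' [T0 lea n0]]].
apply: (@null_le _ _ _ _ _ _ (nds_ax S') (f (\sum_i nds_op S (a i) (a' i)))).
  apply: (le_trans (nds_ax S') (le_morphism_sum _)).
  apply: (le_sum (nds_ax S')) => i.
  have [[Ta _] [le1 le2]] := (T0 i, lea i); rewrite le_morphism_mulT0 //.
  by apply: (nds_mul (nds_ax S')); apply: (lem_le Pf).
by rewrite /null /= -(lem_0 Pf); apply: (lem_le Pf).
Qed.

End LeMorphism.

Lemma hsft_coherent_fuzzy_ring (S : HSfT) :
  coherent_fuzzy_ring (nds_1 S) (nds_op S)
    (nds_neg S (nds_1 S)) (null (nds_le S)).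
Proof.
exact: hyper_type_coherent_fuzzy_ring (nds_ax S) (@hsft_hyper S) (hsft_units S).
Qed.

Definition fuzzyRing_of (S : HSfT) : FR :=
  FuzzyRing (hsft_coherent_fuzzy_ring S).

Lemma le_morphism_fuzzy (S S' : HSfT) (f : S -> S') : le_morphism f ->
  @fuzzy_morphism (fuzzyRing_of S) (fuzzyRing_of S') f.
Proof.
move=> Pf; split; rewrite /fr_units /= -?hsft_units.
- by move=> a [/(lem_T Pf)|->]; [left|right; apply: lem_0 Pf].
- exact: (lem_0 Pf).
- exact: (lem_1 Pf).
- exact: (lem_mull Pf).
- exact: (lem_mulr Pf).
- by move=> n b c; apply: (le_morphism_null Pf); apply: hsft_hyper.
Qed.

Definition fuzzyHom_of (S S' : HSfT) (f : hom S S') :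
  hom (fuzzyRing_of S) (fuzzyRing_of S') :=
  FuzzyHom (le_morphism_fuzzy (leHomP f)).

Definition fuzzy_functor : functor_on HSfT FR fuzzyRing_of.
Proof.
by exists fuzzyHom_of => *; apply: fuzzyHom_eq.
Defined.

Theorem theorem6p4 :
  exists (h : forall S : HSfT,
             coherent_fuzzy_ring (nds_1 S) (nds_op S)
               (nds_neg S (nds_1 S)) (null (nds_le S)))
         (F : functor_on HSfT FR (fun S => FuzzyRing (h S))),
    forall (S S' : HSfT) (f : hom S S') (b : S),
      fuzzyHom_fun (fmap F f) b = leHom_fun f b.
Proof. by exists hsft_coherent_fuzzy_ring, fuzzy_functor. Qed.
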